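(* Let $q\in\mathbb{C}\setminus\{0,1\}$ and, for $n\in\mathbb{Z}$, put $\{n\}=\frac{1-q^n}{1-q}$. Let $\mathfrak{A}_q$ be the complex superspace with basis $\{L_m, I_m\mid m\in\mathbb{Z}\}$ of parity $0$ and $\{G_m,T_m\mid m\in\mathbb{Z}\}$ of parity $1$. Let $[\cdot,\cdot]_q$ be the super-skew-symmetric bilinear bracket on $\mathfrak{A}_q$ determined, for $m,n\in\mathbb{Z}$, by $$[L_m,L_n]_q=(\{m\}-\{n\})L_{m+n},\quad [L_m,I_n]_q=-\{n\}I_{m+n},\quad [L_m,G_n]_q=(\{m\}-\{n+1\})G_{m+n},$$ $$[I_m,G_n]_q=\{m\}T_{m+n},\quad [L_m,T_n]_q=-\{n+1\}T_{m+n},$$ $$[I_m,I_n]_q=[I_m,T_n]_q=[T_m,G_n]_q=[T_m,T_n]_q=[G_m,G_n]_q=0,$$ and let $\alpha_q$ be the even linear map with $$\alpha_q(L_n)=(1+q^n)L_n,\quad \alpha_q(I_n)=(1+q^n)I_n,\quad \alpha_q(G_n)=(1+q^{n+1})G_n,\quad \alpha_q(T_n)=(1+q^{n+1})T_n .$$ Then $(\mathfrak{A}_q,[\cdot,\cdot]_q,\alpha_q)$ is a Hom-Lie superalgebra.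
   Context: A Hom-Leibniz superalgebra is a triple $(\mathcal{A},[\cdot,\cdot],\alpha)$ where $\mathcal{A}=\mathcal{A}_0\oplus\mathcal{A}_1$ is a $\mathbb{Z}_2$-graded vector space, $[\cdot,\cdot]$ is a bilinear map with $[\mathcal{A}_i,\mathcal{A}_j]\subset\mathcal{A}_{i+j}$, and $\alpha:\mathcal{A}\to\mathcal{A}$ is an even linear map such that for all homogeneous $x,y,z$ $$[[x,y],\alpha(z)]=[\alpha(x),[y,z]]-(-1)^{|x||y|}[\alpha(y),[x,z]].$$ It is a Hom-Lie superalgebra if moreover the bracket is super-skew-symmetric: $[x,y]=-(-1)^{|x||y|}[y,x]$ for all homogeneous $x,y$. Here $|x|$ denotes the $\mathbb{Z}_2$-degree of a homogeneous element $x$. *)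

(* Defs.v *)
From HB Require Import structures.
From mathcomp Require Import all_boot all_order all_algebra sesquilinear.
From mathcomp Require Import complex reals finmap monalg.

Set Implicit Arguments.
Unset Strict Implicit.
Unset Printing Implicit Defensive.

Import GRing.Theory.
Local Open Scope ring_scope.

(* Degrees in Z/2 are booleans: [true] is the odd degree, addition is [(+)]
   and multiplication is [&&], so that [(-1) ^+ (i && j)] is (-1)^(ij). *)

Record superspace (K : fieldType) (V : lmodType K) (A : bool -> {pred V})
    : Prop := Superspace {
  superspace_submod : forall i, GRing.submod_closed (A i);
  superspace_span : forall x, exists x0 x1,
    [/\ x0 \in A false, x1 \in A true & x = x0 + x1];
  superspace_direct : forall x, x \in A false -> x \in A true -> x = 0
}.

Record hom_leibniz_superalgebra (K : fieldType) (V : lmodType K)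
    (A : bool -> {pred V}) (br : V -> V -> V) (alpha : V -> V)
    : Prop := HomLeibnizSuperalgebra {
  hom_superspace : superspace A;
  hom_bilinear : bilinear_for *:%R *:%R br;
  hom_bracket_deg : forall i j x y,
    x \in A i -> y \in A j -> br x y \in A (i (+) j);
  hom_linear : linear alpha;
  hom_even : forall i x, x \in A i -> alpha x \in A i;
  hom_leibniz : forall i j k x y z, x \in A i -> y \in A j -> z \in A k ->
    br (br x y) (alpha z) =
      br (alpha x) (br y z) - (-1) ^+ (i && j) *: br (alpha y) (br x z)
}.

Definition super_skew_symmetric (K : fieldType) (V : lmodType K)
    (A : bool -> {pred V}) (br : V -> V -> V) : Prop :=
  forall i j x y, x \in A i -> y \in A j ->
    br x y = - ((-1) ^+ (i && j) *: br y x).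

Definition hom_lie_superalgebra (K : fieldType) (V : lmodType K)
    (A : bool -> {pred V}) (br : V -> V -> V) (alpha : V -> V) : Prop :=
  hom_leibniz_superalgebra A br alpha /\ super_skew_symmetric A br.

Inductive gen : Type := gL of int | gI of int | gG of int | gT of int.

Definition gen_code (a : gen) : int * (bool * bool) :=
  match a with
  | gL m => (m, (false, false))
  | gI m => (m, (false, true))
  | gG m => (m, (true, false))
  | gT m => (m, (true, true))
  end.

Definition gen_decode (c : int * (bool * bool)) : gen :=
  let: (m, (odd, b)) := c in
  if odd then if b then gT m else gG m else if b then gI m else gL m.

Lemma gen_codeK : cancel gen_code gen_decode.
Proof. by case. Qed.

HB.instance Definition _ := Countable.copy gen (can_type gen_codeK).

Definition parity (a : gen) : bool :=
  match a with gL _ | gI _ => false | gG _ | gT _ => true end.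

Section Aq.
Variable K : fieldType.

(* The free K-module on [gen]; the basis vector of [a : gen] is [<< a >>]. *)
Definition Aq : lmodType K := {malg K[gen]}.

Definition Aq_part (i : bool) : {pred Aq} :=
  [pred x : Aq | all (fun a => parity a == i) (enum_fset (msupp x))].

Definition lin_ext (V : lmodType K) (f : gen -> V) (x : Aq) : V :=
  \sum_(a <- msupp x) x@_a *: f a.

Variable q : K.

Definition qint (n : int) : K := (1 - q ^ n) / (1 - q).

(* [None] marks the ordered pairs of generators whose bracket is not listed
   but obtained from the opposite pair by super-skew-symmetry. *)
Definition bracket_table (a b : gen) : option Aq :=
  match a, b with
  | gL m, gL n => Some ((qint m - qint n) *: << gL (m + n) >>)
  | gL m, gI n => Some (- qint n *: << gI (m + n) >>)
  | gL m, gG n => Some ((qint m - qint (n + 1)) *: << gG (m + n) >>)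
  | gI m, gG n => Some (qint m *: << gT (m + n) >>)
  | gL m, gT n => Some (- qint (n + 1) *: << gT (m + n) >>)
  | gI _, gI _ | gI _, gT _ | gT _, gG _ | gT _, gT _ | gG _, gG _ => Some 0
  | gI _, gL _ | gG _, gL _ | gG _, gI _ | gT _, gL _ | gT _, gI _ | gG _, gT _ => None
  end.

Definition bracket_gen (a b : gen) : Aq :=
  match bracket_table a b, bracket_table b a with
  | Some v, _ => v
  | None, Some v => - ((-1) ^+ (parity a && parity b) *: v)
  | None, None => 0 (* does not occur *)
  end.

Definition bracket_q (x y : Aq) : Aq :=
  lin_ext (fun a => lin_ext (fun b => bracket_gen a b) y) x.

Definition alpha_gen (a : gen) : Aq :=
  match a with
  | gL n | gI n => (1 + q ^ n) *: << a >>
  | gG n | gT n => (1 + q ^ (n + 1)) *: << a >>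
  end.

Definition alpha_q : Aq -> Aq := lin_ext alpha_gen.

Lemma lin_extU (V : lmodType K) (f : gen -> V) (a : gen) :
  lin_ext f << a >> = f a.
Proof. by rewrite /lin_ext msuppU oner_eq0 big_seq_fset1 mcoeffUU scale1r. Qed.

Lemma bracket_qE (a b : gen) : bracket_q << a >> << b >> = bracket_gen a b.
Proof. by rewrite /bracket_q !lin_extU. Qed.

Lemma alpha_qE (a : gen) : alpha_q << a >> = alpha_gen a.
Proof. exact: lin_extU. Qed.

Lemma mem_Aq_part (a : gen) : << a >> \in Aq_part (parity a).
Proof.
apply/allP => b.
by rewrite msuppU oner_eq0 inE => /eqP ->.
Qed.

End Aq.

(* Main.v *)
Require Import Defs.
From mathcomp Require Import all_boot all_algebra.
From mathcomp Require Import complex reals.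
From mathcomp Require Import finmap monalg ring.

(** The sixteen families of brackets are values of a single formula.  Let
    P = K[t, t^-1] (x) K[theta]/(theta^2) (x) K[eps]/(eps^2) over the ground
    field K, where theta is odd and t and eps are even, and identify
      L_m = t^m,  I_m = eps t^m,  G_m = theta t^m,  T_m = eps theta t^m.
    Let sigma be the algebra automorphism of P scaling t and theta by q and
    fixing eps, and put D = (sigma - id) / (1 - q).  For x and y free of eps,
    the bracket is that of q-deformed vector fields and of their action on
    functions:
      [x, y] = x D(y) - D(x) y,   [x, eps y] = eps x D(y),
      [eps x, eps y] = 0,
    while alpha = id + sigma.

    On monomials this reads [a, b] = bracket_coef a b *: ab (bracket_genE),
    where the coefficient only involves the eigenvalues w(a), w(b) of sigma
    and whether eps occurs.  As P is associative, and commutative up to signs,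
    the three terms of the Hom-Leibniz identity on monomials a, b, c are
    multiples of the same monomial abc.  If two of a, b, c are odd then all
    three terms vanish because theta^2 = 0; otherwise no sign occurs and w is
    multiplicative on every product involved.  What remains is a polynomial
    identity in w(a), w(b), w(c) (bracket_coef_jacobi).  For instance, with no
    factor eps and after multiplication by (1 - q)^2, it is
      (w(b) - w(a)) (1 + w(c)) (w(c) - w(a) w(b))
        = (1 + w(a)) (w(c) - w(b)) (w(b) w(c) - w(a))
          - (1 + w(b)) (w(c) - w(a)) (w(a) w(c) - w(b)).
    Both sides of the Hom-Leibniz and skew-symmetry identities are linear in
    each argument, so it is enough to know them on the basis
    (linear_eq_part). *)

Import GRing.Theory.

Local Open Scope ring_scope.

(** * The free superspace and linear extension from its basis *)

Section LinearExtension.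
Context {K : fieldType}.
Implicit Types (a : gen) (i : bool) (x y : Aq K).

Lemma Aq_partP i x :
  reflect (forall a, parity a != i -> x@_a = 0) (x \in @Aq_part K i).
Proof.
apply: (iffP allP) => [x_i a | x_i a xa].
  by apply: contraNeq; rewrite mcoeff_neq0 => /x_i.
by apply: contraTT xa => /x_i xa0; rewrite -mcoeff_neq0 xa0 eqxx.
Qed.

Lemma Aq_part_submod i : GRing.submod_closed (@Aq_part K i).
Proof.
split=> [|k x y /Aq_partP x_i /Aq_partP y_i]; apply/Aq_partP => a ai.
  by rewrite mcoeff0.
by rewrite mcoeffD mcoeffZ x_i // y_i // mulr0 addr0.
Qed.

Lemma Aq_part0 i : 0 \in @Aq_part K i.
Proof. exact: (Aq_part_submod i).1. Qed.

Lemma Aq_partD i (k : K) x y :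
  x \in @Aq_part K i -> y \in @Aq_part K i -> k *: x + y \in @Aq_part K i.
Proof. exact: (Aq_part_submod i).2. Qed.

Lemma Aq_partZ i (k : K) x : x \in @Aq_part K i -> k *: x \in @Aq_part K i.
Proof. by move=> xi; rewrite -[_ *: _]addr0 Aq_partD ?Aq_part0. Qed.

Lemma lin_ext_gen x : lin_ext (fun a => << a >> : Aq K) x = x.
Proof.
rewrite [RHS]monalgE; apply: eq_bigr => a _.
by apply/malgP => b; rewrite mcoeffZ !mcoeffU mulrnAr mulr1.
Qed.

(** The supports of [x], [y] and [k *: x + y] differ in general, because of
    cancellations; linearity is visible once the three sums range over a common
    finite set. *)
Lemma lin_ext_linear (V : lmodType K) (f : gen -> V) : linear (lin_ext f).
Proof.
have extE (D : {fset gen}) x : (msupp x `<=` D)%fset ->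
    lin_ext f x = \sum_(a <- D) x@_a *: f a.
  move=> /fsubsetP xD; rewrite /lin_ext (big_fset_incl _ (B := D)) //=.
    exact/fsubsetP.
  by move=> a _; rewrite -mcoeff_eq0 => /eqP ->; rewrite scale0r.
move=> k x y.
pose D := (msupp (k *: x + y) `|` msupp x `|` msupp y)%fset.
rewrite !(extE D) ?scaler_sumr -?big_split /=.
- by apply: eq_bigr => a _; rewrite mcoeffD mcoeffZ scalerDl scalerA.
- by rewrite /D fsubsetUr.
- by rewrite /D -fsetUA fsetUCA fsubsetUl.
- by rewrite /D -fsetUA fsubsetUl.
Qed.

Lemma Aq_part_ind i (P : Aq K -> Prop) :
    P 0 -> (forall (k : K) x y, P x -> P y -> P (k *: x + y)) ->
    (forall a, parity a = i -> P << a >>) ->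
  forall x, x \in @Aq_part K i -> P x.
Proof.
move=> P0 PD Pg x /allP xi; rewrite -[x]lin_ext_gen /lin_ext big_seq.
by elim/big_rec: _ => // a y /xi /eqP ai Py; apply: PD => //; apply: Pg.
Qed.

Lemma linear_at0 {U V : lmodType K} {h : U -> V} : linear h -> h 0 = 0.
Proof.
by move=> hlin; have := hlin (-1) 0 0; rewrite !scaleN1r oppr0 addr0 addNr.
Qed.

(** Multilinear identities between homogeneous elements are obtained from the
    basis by applying this to one argument at a time. *)
Lemma linear_eq_part (V : lmodType K) (f g : Aq K -> V) i :
    linear f -> linear g -> (forall a, parity a = i -> f << a >> = g << a >>) ->
  forall x, x \in @Aq_part K i -> f x = g x.
Proof.
move=> flin glin fg; apply: Aq_part_ind => //; first by rewrite !linear_at0.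
by move=> k x y fgx fgy; rewrite flin glin fgx fgy.
Qed.

Lemma Aq_superspace : superspace (@Aq_part K).
Proof.
split=> [|x|x /Aq_partP x0 /Aq_partP x1]; first exact: Aq_part_submod.
  pose pr i := \sum_(a <- msupp x | parity a == i) x@_a *: << a >> : Aq K.
  have pr_i i : pr i \in @Aq_part K i.
    rewrite /pr; elim/big_rec: _ => [|a y /eqP <- y_i]; first exact: Aq_part0.
    by apply: Aq_partD => //; apply: mem_Aq_part.
  exists (pr false), (pr true); split=> //.
  rewrite -[LHS]lin_ext_gen /lin_ext (bigID (fun a => parity a == false)) /=.
  by congr (_ + _); apply: eq_bigl => a; case: parity.
by apply/malgP => a; rewrite mcoeff0; case a_p: (parity a);
  [apply: x0 | apply: x1]; rewrite a_p.
Qed.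

End LinearExtension.

(** * The generators as monomials *)

Section Generators.
Context {K : fieldType}.
Variable q : K.
Implicit Types a b c : gen.

Definition deg a : int := (gen_code a).1.

(** The last bit of the code separates the I_m and T_m, which are the multiples
    of eps, from the L_m and G_m. *)
Definition has_eps a : bool := (gen_code a).2.2.

(** The eigenvalue of sigma on the monomial [a]: theta contributes one more
    factor q. *)
Definition weight a : K := q ^ (if parity a then deg a + 1 else deg a).

(** The monomial underlying the product in P.  It is a junk value when theta or
    eps occurs in both factors; [bracket_coef] vanishes there. *)
Definition gen_mul a b : gen :=
  gen_decode (deg a + deg b, (parity a || parity b, has_eps a || has_eps b)).

(** The relation theta^2 = 0 gives the first case.  In the second, x D(y) - D(x) y
    has coefficient (w(b) - w(a)) / (1 - q), and replacing the weight of each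
    monomial by 1 when the other one contains eps covers the remaining brackets:
    w(b) - 1 is the eigenvalue of (1 - q) D on b, and two factors eps give
    1 - 1 = 0. *)
Definition bracket_coef a b : K :=
  if parity a && parity b then 0
  else ((if has_eps a then 1 else weight b) - (if has_eps b then 1 else weight a))
       / (1 - q).

Lemma bracket_genE a b :
  bracket_gen q a b = bracket_coef a b *: << gen_mul a b >>.
Proof.
case: a b => [] m [] n;
  rewrite /bracket_gen /bracket_coef /gen_mul /weight /= ?scale1r
    ?scale0r ?scaler0 ?oppr0 ?expr0 ?scale1r ?(addrC n m) -?scaleNr
    ?subrr ?mul0r ?scale0r //; congr (_ *: _); rewrite /qint /deg /=; ring.
Qed.

Lemma alpha_genE a : alpha_gen q a = (1 + weight a) *: << a >>.
Proof. by case: a. Qed.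

Lemma parity_mul a b : parity (gen_mul a b) = parity a || parity b.
Proof. by case: a b => [] m []. Qed.

Lemma has_eps_mul a b : has_eps (gen_mul a b) = has_eps a || has_eps b.
Proof. by case: a b => [] m []. Qed.

Lemma gen_mulC a b : gen_mul a b = gen_mul b a.
Proof. by rewrite /gen_mul addrC orbC [has_eps a || _]orbC. Qed.

Lemma gen_mulA a b c : gen_mul a (gen_mul b c) = gen_mul (gen_mul a b) c.
Proof. by case: a b c => [] m [] n [] p; rewrite /gen_mul /= addrA. Qed.

Lemma gen_mulCA a b c : gen_mul a (gen_mul b c) = gen_mul b (gen_mul a c).
Proof. by rewrite !gen_mulA (gen_mulC a). Qed.

Lemma weight_mul a b : q != 0 -> ~~ (parity a && parity b) ->
  weight (gen_mul a b) = weight a * weight b.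
Proof.
move=> q0; case: a b => [] m [] n //= _;
  by rewrite /weight /= -expfzDr // ?addrA // addrAC.
Qed.

Lemma bracket_coefC a b : bracket_coef a b = - bracket_coef b a.
Proof.
rewrite /bracket_coef andbC; case: ifP => _; first by rewrite oppr0.
by rewrite -mulNr opprB.
Qed.

(** The Hom-Leibniz identity for structure constants.  When two of the monomials
    are odd, each of the three terms contains a bracket of two odd monomials.
    Otherwise all signs are 1, and each of the eight distributions of eps gives
    a polynomial identity in the weights and (1 - q)^-1. *)
Lemma bracket_coef_jacobi a b c : q != 0 ->
  bracket_coef a b * (1 + weight c) * bracket_coef (gen_mul a b) c =
    (1 + weight a) * bracket_coef b c * bracket_coef a (gen_mul b c)
    - (-1) ^+ (parity a && parity b)
      * ((1 + weight b) * bracket_coef a c * bracket_coef b (gen_mul a c)).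
Proof.
move=> q0; rewrite /bracket_coef !parity_mul !has_eps_mul.
case: (boolP (parity a && parity b)) => [/andP[-> ->]|ab] /=.
  by case: (parity c); rewrite /= ?(mul0r, mulr0, subr0, oppr0).
case: (boolP (parity a && parity c)) => [/andP[-> ->]|ac] /=.
  by rewrite ?orbT ?andbT /= ?(mul0r, mulr0, subr0, oppr0).
case: (boolP (parity b && parity c)) => [/andP[-> ->]|bc] /=.
  by rewrite ?orbT ?andbT /= ?(mul0r, mulr0, subr0, oppr0).
rewrite !weight_mul // !andb_orr !andb_orl.
rewrite (negPf ab) (negPf ac) (negPf bc) [parity b && _]andbC (negPf ab) /=.
by case: (has_eps a); case: (has_eps b); case: (has_eps c) => /=; ring.
Qed.

End Generators.

(** * The Hom-Lie structure *)

Section HomLie.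
Context {K : fieldType}.
Variable q : K.
Implicit Types (x y z : Aq K) (i j k : bool).

Local Notation br := (bracket_q q).
Local Notation al := (alpha_q q).

Lemma alpha_q_linear : linear al.
Proof. exact: lin_ext_linear. Qed.

Lemma bracket_q_linearl y : linear (br^~ y).
Proof. by move=> s x x'; apply: lin_ext_linear. Qed.

(** [bracket_q] expands its left argument first, so linearity on the right is
    seen after exchanging the two sums. *)
Lemma bracket_q_linearr x : linear (br x).
Proof.
have brE y : br x y = lin_ext (fun b => lin_ext (fun a => bracket_gen q a b) x) y.
  rewrite /bracket_q /lin_ext.
  under eq_bigr do rewrite scaler_sumr.
  rewrite exchange_big /=; apply: eq_bigr => b _.
  rewrite scaler_sumr; apply: eq_bigr => a _.
  by rewrite !scalerA mulrC.
by move=> s y y'; rewrite !brE lin_ext_linear.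
Qed.

Lemma bracket_qZl (s : K) x y : br (s *: x) y = s *: br x y.
Proof. exact: (scalable_linear (bracket_q_linearl y)). Qed.

Lemma bracket_qZr (s : K) x y : br x (s *: y) = s *: br x y.
Proof. exact: (scalable_linear (bracket_q_linearr x)). Qed.

Lemma bracket_q_gen a b :
  br << a >> << b >> = bracket_coef q a b *: << gen_mul a b >>.
Proof. by rewrite bracket_qE bracket_genE. Qed.

Lemma alpha_q_gen a : al << a >> = (1 + weight q a) *: << a >>.
Proof. by rewrite alpha_qE alpha_genE. Qed.

Lemma bracket_q_deg i j x y :
  x \in @Aq_part K i -> y \in @Aq_part K j -> br x y \in @Aq_part K (i (+) j).
Proof.
move=> xi yj; move: x xi.
apply: (@Aq_part_ind _ i (fun x => br x y \in _)) => [|s x x' IHx IHx'|a ai].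
- by rewrite (linear_at0 (bracket_q_linearl y)) Aq_part0.
- by rewrite bracket_q_linearl Aq_partD.
move: y yj.
apply: (@Aq_part_ind _ j (fun y => br _ y \in _)) => [|s y y' IHy IHy'|b bj].
- by rewrite (linear_at0 (bracket_q_linearr _)) Aq_part0.
- by rewrite bracket_q_linearr Aq_partD.
rewrite bracket_q_gen /bracket_coef ai bj.
case: (boolP (i && j)) => ij; first by rewrite scale0r Aq_part0.
suff -> : i (+) j = parity (gen_mul a b) by rewrite Aq_partZ ?mem_Aq_part.
by rewrite parity_mul ai bj; case: i j ij {ai bj} => [] [].
Qed.

Lemma alpha_q_even i x : x \in @Aq_part K i -> al x \in @Aq_part K i.
Proof.
move: x.
apply: (@Aq_part_ind _ i (fun x => al x \in _)) => [|s x y IHx IHy|a <-].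
- by rewrite (linear_at0 alpha_q_linear) Aq_part0.
- by rewrite alpha_q_linear Aq_partD.
by rewrite alpha_q_gen Aq_partZ ?mem_Aq_part.
Qed.

Lemma bracket_q_skew : super_skew_symmetric (@Aq_part K) br.
Proof.
have linN (s : K) (f : Aq K -> Aq K) :
    linear f -> linear (fun x => - (s *: f x)).
  move=> flin t x y; rewrite flin scalerDr opprD scalerN !scalerA.
  by rewrite [s * t]mulrC.
move=> i j x y xi yj; move: x xi.
apply: linear_eq_part => [||a ai]; first exact: bracket_q_linearl.
  exact/linN/bracket_q_linearr.
move: y yj.
apply: linear_eq_part => [||b bj]; first exact: bracket_q_linearr.
  exact/linN/bracket_q_linearl.
rewrite !bracket_q_gen gen_mulC bracket_coefC -ai -bj scaleNr scalerA.
rewrite /bracket_coef andbC.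
(* The coefficient vanishes on two odd monomials, the only case with a sign. *)
by case: (parity a && parity b); rewrite ?mulr0 ?expr0 ?mul1r.
Qed.

Lemma bracket_q_hom_leibniz i j k x y z : q != 0 ->
    x \in @Aq_part K i -> y \in @Aq_part K j -> z \in @Aq_part K k ->
  br (br x y) (al z) =
    br (al x) (br y z) - (-1) ^+ (i && j) *: br (al y) (br x z).
Proof.
have linB (s : K) (f g : Aq K -> Aq K) :
    linear f -> linear g -> linear (fun x => f x - s *: g x).
  move=> flin glin t u v; rewrite flin glin scalerDr opprD addrACA scalerBr.
  by rewrite !scalerA [s * t]mulrC.
have brl := bracket_q_linearl; have brr := bracket_q_linearr.
have alin := alpha_q_linear.
move=> q0 xi yj zk; move: x xi.
apply: linear_eq_part => [t u v||a ai]; first by rewrite !brl.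
  by apply: linB => t u v; rewrite ?alin ?brl ?brr.
move: y yj; apply: linear_eq_part => [t u v||b bj]; first by rewrite brr brl.
  by apply: linB => t u v; rewrite ?alin ?brl ?brr.
move: z zk; apply: linear_eq_part => [t u v||c ck]; first by rewrite alin brr.
  by apply: linB => t u v; rewrite ?alin ?brl ?brr.
rewrite !alpha_q_gen !bracket_q_gen.
rewrite !(bracket_qZl, bracket_qZr) !bracket_q_gen.
(* All three terms become multiples of the monomial abc. *)
rewrite -gen_mulA [gen_mul b (gen_mul a c)]gen_mulCA !scalerA -scalerBl.
by rewrite bracket_coef_jacobi // ai bj !mulrA.
Qed.

Theorem Aq_hom_lie_superalgebra : q != 0 ->
  hom_lie_superalgebra (@Aq_part K) br al.
Proof.
move=> q0; split; last exact: bracket_q_skew.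
split.
- exact: Aq_superspace.
- by split; [exact: bracket_q_linearl | exact: bracket_q_linearr].
- exact: bracket_q_deg.
- exact: alpha_q_linear.
- exact: alpha_q_even.
- by move=> i j k x y z; apply: bracket_q_hom_leibniz.
Qed.

End HomLie.

Theorem proposition1p7 (R : realType) (q : R[i])
    (q_neq0 : q != 0) (q_neq1 : q != 1) :
  hom_lie_superalgebra (@Aq_part R[i]) (bracket_q q) (alpha_q q).
Proof. exact: Aq_hom_lie_superalgebra. Qed.
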